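(* Let $p$ be a positive prime, let $(r,p)$ be a first-degree prime ideal of $\mathbb{Z}[\alpha]$ and let $(s,p)$ be a first-degree prime ideal of $\mathbb{Z}[\beta]$. Then $(r+s,p)$ is a first-degree prime ideal of $\mathbb{Z}[\gamma]$.
   Context: Setting: $a,b\in\mathbb{Z}$ have distinct non-trivial square-free parts, $\alpha,\beta\in\mathbb{C}$ satisfy $\alpha^2=a$, $\beta^2=b$ (so $\mathbb{Q}(\alpha)$ and $\mathbb{Q}(\beta)$ are distinct quadratic fields), and $\gamma=\alpha+\beta$, so that $\mathbb{Q}(\gamma)$ is the biquadratic field generated by $\alpha$ and $\beta$. The minimal polynomials over $\mathbb{Q}$ of $\alpha,\beta,\gamma$ are respectively $f_a(x)=x^2-a$, $f_b(x)=x^2-b$, $f_c(x)=x^4-2(a+b)x^2+(a-b)^2$. For an algebraic integer $\theta$, the norm of a non-zero ideal $\mathfrak{a}$ of $\mathbb{Z}[\theta]$ is $[\mathbb{Z}[\theta]:\mathfrak{a}]$, and a non-zero prime ideal of $\mathbb{Z}[\theta]$ is called a first-degree prime ideal if its norm is a prime integer. If $f$ is the minimal polynomial of $\theta$ and $p$ is a positive prime, the prime ideals of $\mathbb{Z}[\theta]$ of norm $p$ are in bijection with the pairs $(r,p)$ with $r\in\mathbb{Z}/p\mathbb{Z}$ and $f(r)\equiv 0 \bmod p$; the pair $(r,p)$ is identified with the kernel of the ring morphism $\pi_\theta:\mathbb{Z}[\theta]\to\mathbb{Z}/p\mathbb{Z}$ sending $\theta\mapsto r$. Thus ''$(r,p)$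 is a first-degree prime ideal of $\mathbb{Z}[\theta]$'' means that $f(r)\equiv 0\bmod p$, and the ideal denoted is this kernel. *)

(* Defs.v *)
From HB Require Import structures.
From mathcomp Require Import all_boot all_order all_algebra all_field.
From mathcomp Require Import boolp.

Set Implicit Arguments.
Unset Strict Implicit.
Unset Printing Implicit Defensive.

Import GRing.Theory.
Local Open Scope ring_scope.

Definition squarefree (d : int) : Prop :=
  d != 0 /\ forall k : int, (k ^+ 2 %| d)%Z -> `|k|%N = 1%N.

(* The square-free part carries the sign of a. It is only defined for a != 0
   (a = 0 has no square-free part), and it is non-trivial when it is not 1. *)
Definition is_squarefree_part (a d : int) : Prop :=
  squarefree d /\ exists2 k : int, k != 0 & a = d * k ^+ 2.

(* The subring Z[theta] of the complex algebraic numbers. *)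
Definition zadj (theta : algC) : {pred algC} :=
  fun x => `[< exists q : {poly int}, x = (map_poly intr q).[theta] >].

Lemma zadj_subring theta : subring_closed (zadj theta).
Proof.
split=> [|x y /asboolP[q ->] /asboolP[q' ->]|x y /asboolP[q ->] /asboolP[q' ->]].
- by apply/asboolP; exists 1; rewrite rmorph1 hornerC.
- by apply/asboolP; exists (q - q'); rewrite rmorphB hornerD hornerN.
- by apply/asboolP; exists (q * q'); rewrite rmorphM hornerM.
Qed.

HB.instance Definition _ theta :=
  GRing.isSubringClosed.Build algC (zadj theta) (zadj_subring theta).

Record Zadj (theta : algC) := MkZadj {
  Zadj_val :> algC;
  Zadj_valP : Zadj_val \in zadj theta
}.

HB.instance Definition _ theta := [isSub for @Zadj_val theta].
HB.instance Definition _ theta := [Choice of Zadj theta by <:].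
HB.instance Definition _ theta :=
  [SubChoice_isSubComNzRing of Zadj theta by <:].

Lemma zadj_gen theta : theta \in zadj theta.
Proof. by apply/asboolP; exists 'X; rewrite map_polyX hornerX. Qed.

Definition Zgen (theta : algC) : Zadj theta := MkZadj (zadj_gen theta).

(* [R : I] = n : some n elements represent each class modulo I exactly once. *)
Definition ideal_norm (R : comNzRingType) (I : {pred R}) (n : nat) : Prop :=
  exists t : 'I_n -> R, forall x : R, exists! i : 'I_n, x - t i \in I.

(* idealr_closed includes 1 \notin I, so I is proper. *)
Definition first_degree_prime_ideal (R : comNzRingType) (I : {pred R}) : Prop :=
  [/\ idealr_closed I, prime_idealr_closed I, exists2 x, x \in I & x != 0 &
      exists2 q : nat, prime q & ideal_norm I q].

Definition kernel (R S : nzRingType) (pi : {rmorphism R -> S}) : {pred R} :=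
  [pred x | pi x == 0].

(* "(r, p) is a first-degree prime ideal of Z[theta]": the minimal polynomial
   of theta has integer coefficients and vanishes at r modulo p, and the ideal
   denoted by (r, p), the kernel of the morphism Z[theta] -> Z/pZ sending theta
   to r (which is unique), is a first-degree prime ideal, of norm p. For an
   algebraic integer theta and a prime p, the congruence alone implies the
   rest. *)
Definition is_first_degree_prime (theta : algC) (p : nat) (r : 'F_p) : Prop :=
  (exists2 f : {poly int}, map_poly intr f = minCpoly theta &
     root (map_poly intr f : {poly 'F_p}) r) /\
  (exists pi : {rmorphism Zadj theta -> 'F_p},
     [/\ pi (Zgen theta) = r, first_degree_prime_ideal (kernel pi) &
         ideal_norm (kernel pi) p]).
Arguments is_first_degree_prime theta p r : clear implicits.

(* Main.v *)
Require Import Defs.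
From HB Require Import structures.
From mathcomp Require Import all_boot all_order all_algebra all_field.
From mathcomp Require Import boolp ring lra.
Import GRing.Theory Num.Theory.
Local Open Scope ring_scope.

(** Write [theta] for [alpha + beta] and [rho] for [r + s].  A ring morphism
    from Z[theta] to F_p with [theta |-> rho] exists as soon as every integer
    polynomial vanishing at [theta] also vanishes at [rho]
    ([Zadj_eval_morphism]).  Since r^2 = a and s^2 = b modulo p, just as
    alpha^2 = a and beta^2 = b, one and the same computation reduces q(theta)
    to A + B alpha + C beta + D alpha beta and q(rho) to A + B r + C s + D r s,
    with the same integers A, B, C, D ([horner_sum_sqrt]).  The numbers
    1, alpha, beta, alpha beta are linearly independent over Z, because none
    of a, b, ab is a square ([biquadratic_free]); so q(theta) = 0 forces
    A = B = C = D = 0, and then q(rho) = 0.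

    The minimal polynomial of [theta] has integer coefficients because [theta]
    is an algebraic integer, and it vanishes at [rho] by the same implication.  Finally, the kernel of any ring morphism to F_p from a ring in
    which p is non-zero is a first-degree prime ideal of norm p. *)

(** * Square-free parts *)

(** After division by gcd(x, y), coprimality gives x^2 | e and y^2 | d, so
    square-freeness leaves only x^2 = y^2 = 1. *)
Lemma squarefree_ratio_square {d e x y : int} :
  squarefree d -> squarefree e -> d * x ^+ 2 = e * y ^+ 2 -> y != 0 -> d = e.
Proof.
move=> [d0 sd] [e0 se] E y0.
have g0 : gcdz x y != 0 by rewrite gcdz_eq0 negb_and y0 orbT.
have := divzK (dvdz_gcdl x y); have := divzK (dvdz_gcdr x y).
set x' := (x %/ _)%Z; set y' := (y %/ _)%Z; set g := gcdz x y => Ey Ex.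
have cop : coprimez x' y'.
  rewrite /coprimez -(inj_eq (mulIf g0)) mul1r.
  have -> : gcdz x' y' * gcdz x y = gcdz (x' * g) (y' * g) by rewrite -mulz_gcdl.
  by rewrite Ex Ey.
have E' : d * x' ^+ 2 = e * y' ^+ 2.
  apply: (mulIf (expf_neq0 2 g0)).
  by move: E; rewrite -{1}Ex -{1}Ey !exprMn !mulrA.
have dvd_e : (x' ^+ 2 %| e)%Z.
  rewrite -(@Gauss_dvdzl _ _ (y' ^+ 2)); last by rewrite coprimezXl ?coprimezXr.
  by rewrite -E' dvdz_mull.
have dvd_d : (y' ^+ 2 %| d)%Z.
  rewrite -(@Gauss_dvdzl _ _ (x' ^+ 2)).
    by rewrite E' dvdz_mull.
  by rewrite coprimezXl ?coprimezXr // coprimez_sym.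
have sq1 (z : int) : `|z|%N = 1%N -> z ^+ 2 = 1.
  by move=> z1; rewrite -(real_normK (num_real z)) -abszE z1.
by move: E'; rewrite !sq1 ?mulr1 //; [apply: sd | apply: se].
Qed.

Lemma squarefree1 : squarefree 1.
Proof.
split=> // k; rewrite dvdz1 abszX => /eqP.
by rewrite -mulnn => /eqP; rewrite muln_eq1 => /andP[/eqP].
Qed.

(** With 1 as the square-free part of 1, this also yields the non-squareness
    of a single integer; in general it says that ab is not a square. *)
Lemma squarefree_part_ratio {a b d e x y : int} :
    is_squarefree_part a d -> is_squarefree_part b e -> d != e ->
  a * x ^+ 2 = b * y ^+ 2 -> x = 0 /\ y = 0.
Proof.
move=> [sd [k k0 ->]] [se [l l0 ->]] de E.
have y0 : y = 0.
  apply: contraNeq de => y0; apply/eqP.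
  apply: (@squarefree_ratio_square _ _ (k * x) (l * y)) => //.
    by rewrite !exprMn mulrA E -mulrA.
  by rewrite mulf_neq0.
split=> //; move/eqP: E; rewrite y0 expr0n mulr0 !mulf_eq0 (negbTE k0) orbF.
by case: sd => /negbTE-> _ /orP[//|]; rewrite orbb => /eqP.
Qed.

(** * Linear independence of 1, alpha, beta, alpha beta *)

(** Squaring x + y alpha = - (z + w alpha) beta and comparing the coordinates
    on 1 and alpha gives x^2 + a y^2 = b (z^2 + a w^2) and x y = b z w.  Hence
    x^2 - a y^2 = +/- b (z^2 - a w^2); for either sign, the sum and the
    difference with the first equation are relations of the form
    c m^2 = d n^2 with distinct square-free parts, which force m = n = 0. *)
Lemma biquadratic_free {a b da db : int}
    (Ha : is_squarefree_part a da) (Hb : is_squarefree_part b db)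
    (Hda : da != 1) (Hdb : db != 1) (Hdab : da != db)
    {alpha beta : algC}
    (Halpha : alpha ^+ 2 = a%:~R) (Hbeta : beta ^+ 2 = b%:~R) {x y z w : int} :
  x%:~R + y%:~R * alpha + z%:~R * beta + w%:~R * (alpha * beta) = 0 ->
  [/\ x = 0, y = 0, z = 0 & w = 0].
Proof.
have H1 : is_squarefree_part 1 1 by split; [exact: squarefree1 | exists 1].
have a0 : a != 0.
  by case: Ha => [[d0 _] [k k0 ->]]; rewrite mulf_neq0 ?expf_neq0.
have alpha_irr (m n : int) : m%:~R + n%:~R * alpha = 0 -> m = 0 /\ n = 0.
  move=> E; have {}E : a * n ^+ 2 = 1 * m ^+ 2.
    apply: (@intr_inj algC); rewrite !rmorphM /= -Halpha.
    have -> : m%:~R = - (n%:~R * alpha) by apply/eqP; rewrite -addr_eq0 E.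
    by ring.
  by have [-> ->] := squarefree_part_ratio Ha H1 Hda E.
move=> E.
have [E1 E2] : x ^+ 2 + a * y ^+ 2 = b * (z ^+ 2 + a * w ^+ 2)
             /\ x * y = b * (z * w).
  have Esq : (x%:~R + y%:~R * alpha) ^+ 2
             = b%:~R * (z%:~R + w%:~R * alpha) ^+ 2.
    rewrite -Hbeta -exprMn -[RHS]sqrrN; congr (_ ^+ 2).
    by apply/eqP; rewrite -addr_eq0; apply/eqP; rewrite -[RHS]E; ring.
  have [|D1 D2] := alpha_irr (x ^+ 2 + a * y ^+ 2 - b * (z ^+ 2 + a * w ^+ 2))
     (2 * (x * y - b * (z * w))).
    have /eqP := Esq; rewrite -subr_eq0 => /eqP <-.
    by rewrite !(rmorphB, rmorphD, rmorphM, rmorphXn) /= -Halpha; ring.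
  split; first by apply/eqP; rewrite -subr_eq0 D1.
  by apply/eqP; rewrite -subr_eq0; move/eqP: D2; rewrite mulf_eq0.
(* (u - v)^2 = (u + v)^2 - 4 u v, with u = x^2 and v = a y^2, then with
   u = z^2 and v = a w^2. *)
have Enorm : (x ^+ 2 - a * y ^+ 2) ^+ 2 = (b * (z ^+ 2 - a * w ^+ 2)) ^+ 2.
  have -> : (x ^+ 2 - a * y ^+ 2) ^+ 2
     = (x ^+ 2 + a * y ^+ 2) ^+ 2 - 4 * a * (x * y) ^+ 2 by ring.
  by rewrite E1 E2; ring.
move/eqP: Enorm; rewrite eqf_sqr => /orP[] /eqP E3.
- have /(squarefree_part_ratio Hb H1 Hdb)[z0 x0] : b * z ^+ 2 = 1 * x ^+ 2 by lra.
  have Eyw : b * w ^+ 2 = 1 * y ^+ 2.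
    by apply: (mulfI a0); rewrite x0 z0 in E1; lra.
  by have [-> ->] := squarefree_part_ratio Hb H1 Hdb Eyw.
- have /(squarefree_part_ratio Ha Hb Hdab)[y0 z0] : a * y ^+ 2 = b * z ^+ 2 by lra.
  (* x^2 = a b w^2, multiplied by a to become a relation between a and b. *)
  have Exw : a * x ^+ 2 = b * (a * w) ^+ 2.
    by rewrite y0 z0 in E1; have -> : x ^+ 2 = b * (a * w ^+ 2) by [lra|]; ring.
  have [-> /eqP] := squarefree_part_ratio Ha Hb Hdab Exw.
  by rewrite mulf_eq0 (negbTE a0) => /eqP->.
Qed.

(** * Evaluation morphisms on Z[theta] *)

(** The quantifier over [S] comes after the coefficients: the same integers
    serve for algebraic numbers and for their residues modulo p. *)
Lemma horner_sum_sqrt (a b : int) (q : {poly int}) :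
  exists A B C D : int, forall (S : comNzRingType) (u v : S),
    u ^+ 2 = a%:~R -> v ^+ 2 = b%:~R ->
    (map_poly intr q).[u + v]
      = A%:~R + B%:~R * u + C%:~R * v + D%:~R * (u * v).
Proof.
elim/poly_ind: q => [|q c [A [B [C [D IH]]]]].
  by exists 0, 0, 0, 0 => S u v _ _; rewrite rmorph0 horner0; ring.
exists (B * a + C * b + c), (A + D * b), (A + D * a), (B + C) => S u v Eu Ev.
rewrite rmorphD rmorphM /= map_polyX map_polyC /= hornerD hornerMX hornerC.
by rewrite (IH S u v Eu Ev) !(rmorphD, rmorphM) /= -Eu -Ev; ring.
Qed.

(** The hypothesis makes the value at [rho] independent of the integer
    polynomial that represents an element of Z[theta]; a representative is
    picked by choice. *)
Lemma Zadj_eval_morphism {theta : algC} {S : comNzRingType} {rho : S} :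
    (forall q : {poly int}, (map_poly intr q).[theta] = 0 ->
                            (map_poly intr q).[rho] = 0) ->
  exists pi : {rmorphism Zadj theta -> S}, pi (Zgen theta) = rho.
Proof.
move=> wd.
have repr (x : Zadj theta) :
  {q : {poly int} | Zadj_val x = (map_poly intr q).[theta]}.
  by apply: cid; have /asboolP := Zadj_valP x.
pose f x := (map_poly intr (sval (repr x))).[rho].
have fE (x : Zadj theta) q : Zadj_val x = (map_poly intr q).[theta] ->
    f x = (map_poly intr q).[rho].
  rewrite /f; case: (repr x) => q' /= -> E; apply/eqP; rewrite -subr_eq0.
  by rewrite -hornerN -hornerD -rmorphB wd // rmorphB hornerD hornerN E subrr.
have fB : zmod_morphism f.
  move=> x y; rewrite (fE _ (sval (repr x) - sval (repr y))).
    by rewrite rmorphB hornerD hornerN.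
  by rewrite rmorphB hornerD hornerN -(svalP (repr x)) -(svalP (repr y)).
have fM : monoid_morphism f.
  split=> [|x y]; first by rewrite (fE _ 1) rmorph1 hornerC.
  rewrite (fE _ (sval (repr x) * sval (repr y))) rmorphM hornerM //.
  by rewrite -(svalP (repr x)) -(svalP (repr y)).
pose fa := GRing.isZmodMorphism.Build _ _ f fB.
pose fm := GRing.isMonoidMorphism.Build _ _ f fM.
pose F : {rmorphism Zadj theta -> S} := HB.pack f fa fm.
by exists F; rewrite /= (fE _ 'X) map_polyX hornerX.
Qed.

(** * Kernels of morphisms to F_p *)

(** The integers 0, ..., p-1 represent the classes, since a morphism to F_p
    sends them bijectively onto F_p. *)
Lemma ideal_norm_kernel_Fp {R : comNzRingType} {p : nat}
    (pi : {rmorphism R -> 'F_p}) :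
  prime p -> ideal_norm (kernel pi) p.
Proof.
move=> pr_p; exists (fun i : 'I_p => (i : nat)%:R) => x.
have memE (i : 'I_p) :
    (x - (i : nat)%:R \in kernel pi) = (nat_of_ord (pi x) == i).
  rewrite inE rmorphB rmorph_nat subr_eq0 -val_eqE /= val_Fp_nat //.
  by rewrite modn_small.
have ltp : (pi x < p)%N by rewrite -[X in (_ < X)%N](card_Fp pr_p) card_ord.
exists (Ordinal ltp); split=> [|i]; first by rewrite memE /=.
by rewrite memE => /eqP E; apply: val_inj.
Qed.

Lemma first_degree_prime_kernel_Fp {R : comNzRingType} {p : nat}
    (pi : {rmorphism R -> 'F_p}) :
  prime p -> p%:R != 0 :> R -> first_degree_prime_ideal (kernel pi).
Proof.
move=> pr_p p0; split.
- split; rewrite ?inE ?rmorph0 ?rmorph1 ?oner_eq0 //.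
  move=> c x y; rewrite !inE rmorphD rmorphM => /eqP-> /eqP->.
  by rewrite mulr0 addr0.
- by move=> x y; rewrite !inE rmorphM mulf_eq0.
- by exists p%:R; rewrite // inE rmorph_nat pchar_Fp_0.
- by exists p => //; apply: ideal_norm_kernel_Fp.
Qed.

(** * First-degree primes of Z[theta] *)

Lemma Zadj_natr_neq0 (theta : algC) (n : nat) :
  (0 < n)%N -> n%:R != 0 :> Zadj theta.
Proof.
move=> n0; rewrite -(inj_eq val_inj) rmorph_nat rmorph0.
by rewrite pnatr_eq0 -lt0n.
Qed.

Lemma is_first_degree_prime_sqr {theta : algC} {p : nat} {r : 'F_p} {a : int} :
  theta ^+ 2 = a%:~R -> is_first_degree_prime theta p r -> r ^+ 2 = a%:~R.
Proof.
move=> E [_ [pi [<- _ _]]].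
rewrite -rmorphXn /= -(rmorph_int pi); congr (pi _).
by apply: val_inj; rewrite rmorphXn rmorph_int.
Qed.

Lemma Aint_sqrt {theta : algC} {a : int} :
  theta ^+ 2 = a%:~R -> theta \in Aint.
Proof.
move=> E; apply: (@root_monic_Aint ('X^2 - a%:~R%:P)).
- by rewrite /root !hornerE E subrr.
- exact: monicXnsubC.
- have -> : 'X^2 - a%:~R%:P = map_poly intr ('X^2 - a%:P) :> {poly algC}.
    by rewrite rmorphB /= map_polyXn map_polyC.
  by apply/polyOverP => i; rewrite coef_map intr_int.
Qed.

Lemma Aint_minCpoly_int {theta : algC} :
  theta \in Aint -> exists f : {poly int}, map_poly intr f = minCpoly theta.
Proof. by move=> /floorpP[f ->]; exists f. Qed.

Theorem theorem3p1 (a b da db : int)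
    (Ha : is_squarefree_part a da) (Hb : is_squarefree_part b db)
    (Hda : da != 1) (Hdb : db != 1) (Hdab : da != db)
    (alpha beta : algC)
    (Halpha : alpha ^+ 2 = a%:~R) (Hbeta : beta ^+ 2 = b%:~R)
    (p : nat) (Hp : prime p) (r s : 'F_p)
    (Hr : is_first_degree_prime alpha p r)
    (Hs : is_first_degree_prime beta p s) :
  is_first_degree_prime (alpha + beta) p (r + s).
Proof.
have Er := is_first_degree_prime_sqr Halpha Hr.
have Es := is_first_degree_prime_sqr Hbeta Hs.
have relation (q : {poly int}) : (map_poly intr q).[alpha + beta] = 0 ->
    (map_poly intr q).[r + s] = 0.
  have [A [B [C [D evalE]]]] := horner_sum_sqrt a b q.
  rewrite (evalE _ _ _ Halpha Hbeta) (evalE _ _ _ Er Es).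
  move=> /(biquadratic_free Ha Hb Hda Hdb Hdab Halpha Hbeta)[-> -> -> ->].
  by rewrite !mul0r !addr0.
split.
  have [f Ef] : exists f : {poly int}, map_poly intr f = minCpoly (alpha + beta).
    by apply: Aint_minCpoly_int; rewrite rpredD ?(Aint_sqrt Halpha) ?(Aint_sqrt Hbeta).
  exists f => //; rewrite /root relation // Ef.
  exact/eqP/root_minCpoly.
have [pi Epi] := Zadj_eval_morphism relation.
exists pi; split=> //; last exact: ideal_norm_kernel_Fp.
by apply: first_degree_prime_kernel_Fp; rewrite ?Zadj_natr_neq0 ?prime_gt0.
Qed.
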